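(* Let $\frac12<\alpha<1$ and let $X$ be a metric space which is either $\mathrm{SRA}(\alpha)$-free, or proper and locally $\mathrm{SRA}(\alpha)$-free. Then every bounded self-contracted curve $\gamma:I\to X$, where $I\subset\mathbb{R}$ is an interval, is rectifiable.
   Context: For $0<\alpha<1$, a metric space $(Y,d)$ is an $\mathrm{SRA}(\alpha)$ space (satisfies the $\mathrm{SRA}(\alpha)$ condition) if for all $x,y,z\in Y$, $d(x,y)\le\max\{d(x,z)+\alpha d(z,y),\ \alpha d(x,z)+d(z,y)\}$. For $k\in\mathbb{N}$, a metric space $X$ is free of $k$-point $\mathrm{SRA}(\alpha)$ subspaces if no $k$-point subset $Y\subset X$ (with the induced metric) satisfies the $\mathrm{SRA}(\alpha)$ condition. $X$ is $\mathrm{SRA}(\alpha)$-free if it is free of $k$-point $\mathrm{SRA}(\alpha)$ subspaces for some $k\in\mathbb{N}$. $X$ is locally $\mathrm{SRA}(\alpha)$-free if for every $x\in X$ there is $r>0$ such that the open ball $B_r(x)$, with the metric induced from $X$, is $\mathrm{SRA}(\alpha)$-free. A metric space is proper if all its closed balls are compact. A curve is any map $\gamma:I\to X$ from an interval $I\subset\mathbb{R}$, not necessarily continuous. It is self-contracted if $d(\gamma(t_2),\gamma(t_3))\le d(\gamma(t_1),\gamma(t_3))$ for all $t_1\le t_2\le t_3$ in $I$. It is bounded if its image is bounded. It is rectifiable if $\sup\{\sum_{i=1}^{k-1}d(\gamma(t_i),\gamma(t_{i+1})) : k\in\mathbb{N},\ t_1<\dots<t_k,\ t_i\in I\}<\infty$.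 *)

(* Defs.v *)
From mathcomp Require Import all_boot all_order all_algebra.
From mathcomp Require Import all_classical all_reals all_analysis.

Set Implicit Arguments.
Unset Strict Implicit.
Unset Printing Implicit Defensive.

Import Order.TTheory GRing.Theory Num.Theory.
Import numFieldNormedType.Exports.

Local Open Scope classical_set_scope.
Local Open Scope ring_scope.

(* Subspaces of a metric space X are represented by sets [S : set X], carrying
   the restriction of [mdist]; X itself is [setT]. *)

Definition SRA (R : realType) (X : metricType R) (alpha : R) (Y : set X) :=
  forall x y z, Y x -> Y y -> Y z ->
    mdist x y <= Num.max (mdist x z + alpha * mdist z y)
                         (alpha * mdist x z + mdist z y).

(* The empty set is SRA, so no space is free of 0-point SRA subspaces, and
   allowing k = 0 in [SRA_free] is harmless. *)
Definition free_of_SRA (R : realType) (X : metricType R) (k : nat) (alpha : R)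
    (S : set X) :=
  forall Y : set X, Y `<=` S -> (Y #= `I_k)%card -> ~ SRA alpha Y.

Definition SRA_free (R : realType) (X : metricType R) (alpha : R)
    (S : set X) :=
  exists k : nat, free_of_SRA k alpha S.

Definition locally_SRA_free (R : realType) (X : metricType R) (alpha : R) :=
  forall x : X, exists2 r : R, 0 < r & SRA_free alpha (ball x r).

(* [closed_ball] of the library is the closure of the open ball, which can be
   strictly smaller than the closed ball in a general metric space. *)
Definition proper_metric (R : realType) (X : metricType R) :=
  forall (x : X) (r : R), compact [set y : X | mdist x y <= r].

(* A curve I -> X is given by a function on the whole line, of which only the
   values on I are used. *)

Definition self_contracted (R : realType) (X : metricType R) (I : set R)
    (gamma : R -> X) :=
  forall t1 t2 t3, I t1 -> I t2 -> I t3 -> t1 <= t2 -> t2 <= t3 ->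
    mdist (gamma t2) (gamma t3) <= mdist (gamma t1) (gamma t3).

Definition metric_bounded (R : realType) (X : metricType R) (A : set X) :=
  exists M : R, forall x y, A x -> A y -> mdist x y <= M.

Definition polygonal_length (R : realType) (X : metricType R)
    (gamma : R -> X) (s : seq R) : R :=
  \sum_(i < (size s).-1) mdist (gamma s`_i) (gamma s`_i.+1).

Definition curve_length (R : realType) (X : metricType R) (I : set R)
    (gamma : R -> X) : \bar R :=
  ereal_sup [set (polygonal_length gamma s)%:E | s in
    [set s : seq R | sorted <%R s /\ forall t, t \in s -> I t]].

Definition rectifiable (R : realType) (X : metricType R) (I : set R)
    (gamma : R -> X) : Prop :=
  (curve_length I gamma < +oo)%E.

(* Main.v *)
(** The argument works on a finite self-contracted sequence [x 0, x 1, ...] and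
shows that, among points of a set free of k-point SRA(alpha) subspaces, its
length is at most [K] times the distance of its ends, [K] depending on [k] and
[alpha] only.

If [p] is far from [y] and [y'] compared to [d(y,y')], the triple [p, y, y']
satisfies SRA(alpha) as soon as [|d(p,y) - d(p,y')| <= alpha d(y,y')].  So one
gets a large SRA(alpha) set by nesting: inside an interval of the sequence whose
length is huge compared to the distance of its ends (a heavy interval), find a
still heavy interval [[u,v]] and a later, comparatively far index [j] such that
every point [p] chosen before satisfies [d(u,p) - d(j,p) <= alpha d(v,j)]; then
add [j] to the chosen points and continue inside [[u,v]].

Suppose that this step fails in [[s,t]].  Cut [[s,t]] greedily at [w_0 < w_1 < ...],
each [w_(i+1)] being the last index with [len(w_i,w_(i+1)) <= M d(w_i,w_(i+1))].
Each piece but the last has length of the order of [M] times its extent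
[delta_i], so it contains a much smaller heavy interval, because only boundedly
many points of it can be pairwise far apart (Ramsey).  If
[delta_(i+1) >= delta_i / 2], then [w_(i+2)] is far from that heavy interval, so
by assumption the sum over the chosen [p] of [d(.,p)], which is nonincreasing
along the sequence, drops by at least [alpha delta_(i+1)] between [w_i] and
[w_(i+2)].  The other pieces decay geometrically.  Hence the sum of the
[delta_i], and with it the length of [[s,t]], is bounded by a multiple of
[d(s,t)].

In the proper case, compactness gives a radius [rho] and a [k] such that all
[rho]-balls centred at points of the curve are free of k-point SRA(alpha)
subspaces, and a bound on the number of pieces of extent [rho]. *)

Require Import Defs.
From mathcomp Require Import all_boot all_order all_algebra.
From mathcomp Require Import all_classical all_reals all_analysis.
From mathcomp Require Import zify ring lra.

Set Implicit Arguments.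
Unset Strict Implicit.
Unset Printing Implicit Defensive.

Import Order.TTheory GRing.Theory Num.Theory.

Local Open Scope classical_set_scope.
Local Open Scope ring_scope.

(* On index goals [lia] alone case-splits on every real inequality in the context. *)
Ltac idx :=
  repeat match goal with
  | H : is_true (_ && _) |- _ => move/andP: H => [] ? ?
  end;
  repeat match goal with
  | H : ?T |- _ =>
      lazymatch T with
      | is_true (leq _ _) => fail
      | is_true (negb (@eq_op _ (_ : nat) _)) => fail
      | @eq nat _ _ => fail
      | not (@eq nat _ _) => fail
      | _ => clear H
      end
  end;
  repeat (apply/andP; split); lia.

(** * Finite self-contracted sequences and their length *)

Section FiniteSelfContracted.
Context {R : realType} {X : metricType R}.

Definition sc_seq (x : nat -> X) :=
  forall i j k : nat, (i <= j <= k)%N ->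
    mdist (x j) (x k) <= mdist (x i) (x k).

Definition len (x : nat -> X) (i j : nat) : R :=
  \sum_(i <= q < j) mdist (x q) (x q.+1).

Lemma len_cat x {i j k : nat} : (i <= j <= k)%N ->
  len x i k = len x i j + len x j k.
Proof. by case/andP=> ij jk; rewrite /len (big_cat_nat ij jk). Qed.

Lemma len_recr x {i j : nat} : (i <= j)%N ->
  len x i j.+1 = len x i j + mdist (x j) (x j.+1).
Proof. by move=> ij; rewrite /len big_nat_recr. Qed.

Lemma len_id x i : len x i i = 0.
Proof. by rewrite /len big_geq. Qed.

Section OneSequence.
Context {x : nat -> X} (xP : sc_seq x).
Local Notation d i j := (mdist (x i) (x j)).

Lemma sc_mdist_prefix {i j k : nat} : (i <= j <= k)%N -> d i j <= 2 * d i k.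
Proof.
move=> ijk; have := metric_triangle (x i) (x k) (x j).
by rewrite (metric_sym (x k)); have := xP ijk; lra.
Qed.

Lemma sc_mdist_sub {i a b k : nat} : (i <= a <= b)%N -> (b <= k)%N ->
  d a b <= 2 * d i k.
Proof.
move=> iab bk; apply: (le_trans (xP iab)); apply: sc_mdist_prefix; idx.
Qed.

(** Crude, since it counts indices, but it shows that an interval with coinciding ends has length
    0. *)
Lemma len_le {i j : nat} :
  (i <= j)%N -> len x i j <= (j - i)%:R * (2 * d i j).
Proof.
move=> ij; rewrite /len.
apply: (@le_trans _ _ (\sum_(i <= q < j) (2 * d i j))).
  rewrite !big_seq; apply: ler_sum => q; rewrite mem_index_iota => qP.
  by apply: sc_mdist_sub; idx.
by rewrite sumr_const_nat -[leLHS]mulr_natl.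
Qed.

Lemma len_gt0_mdist_gt0 {i j : nat} : (i <= j)%N -> 0 < len x i j -> 0 < d i j.
Proof.
move=> ij; have := len_le ij; have : 0 <= d i j := mdist_ge0 _ _.
rewrite le_eqVlt => /orP[/eqP <-|//]; rewrite !mulr0; lra.
Qed.

(** Cut at the first index at distance more than [r] from the last cut point. A piece costs [L] up
    to the index before the cut and at most [D] for the jump. By [sc_mdist_prefix], all indices from
    the next cut on stay [r / 2] away from the present one, so there are at most [N] pieces. *)
Lemma len_subdivision (r L D : R) (N a b : nat) :
  0 <= r -> 0 <= L -> 0 <= D -> (a <= b)%N ->
  (forall u v : nat, (a <= u <= v)%N -> (v <= b)%N ->
    d u v <= r -> len x u v <= L) ->
  (forall u v : nat, (a <= u <= v)%N -> (v <= b)%N -> d u v <= D) ->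
  (forall z : seq nat, all (fun i => a <= i <= b)%N z ->
     pairwise (fun i j => (i <= j)%N && (r / 2 <= d i j)) z ->
     (size z <= N)%N) ->
  len x a b <= N%:R * (L + D).
Proof.
move=> r0 L0 D0 ab HL HD HN.
suff [z [zab [zr lz]]] : exists z : seq nat, all (fun i => a <= i <= b)%N z /\
    pairwise (fun i j => (i <= j)%N && (r / 2 <= d i j)) z /\
    len x a b <= (size z)%:R * (L + D).
  apply: (le_trans lz); apply: ler_wpM2r; first lra.
  by rewrite ler_nat; exact: HN.
move: HL HD ab {HN}; have [n] := ubnP (b - a)%N.
elim: n a => // n IH a ltn HL HD ab.
case: (pselect (exists y : nat, (a <= y <= b)%N && (r < d a y))) => [ey|ney];
    last first.
  exists [:: a]; split; [rewrite /= leqnn ab|split] => //=.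
  rewrite mul1r; apply: (@le_trans _ _ L); last lra.
  apply: HL; rewrite ?leqnn//; rewrite leNgt; apply/negP => rab.
  by apply: ney; exists b; rewrite ab leqnn.
case: (ex_minnP ey) => y /andP[/andP[ay yb] ry ymin].
have aNy : a <> y by move=> aE; move: ry; rewrite -aE mdistxx ltNge r0.
have [||||z [zyb [zr lz]]] := IH y.
- by idx.
- by move=> u v yu vb; apply: HL => //; idx.
- by move=> u v yu vb; apply: HD => //; idx.
- by [].
exists (a :: z); split; [|split].
- rewrite /= leqnn ab; apply/allP => i /(allP zyb) /=; idx.
- rewrite pairwise_cons zr andbT; apply/allP => i /(allP zyb) /andP[yi ib].
  rewrite (leq_trans ay yi)/=.
  have ayi : (a <= y <= i)%N by rewrite ay.
  by have := sc_mdist_prefix ayi; lra.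
- have ayb : (a <= y.-1 <= b)%N by idx.
  rewrite (len_cat x ayb) /= -natr1 mulrDl mul1r.
  have yE : y = y.-1.+1 by idx.
  have ayb' : (y.-1 <= y <= b)%N by idx.
  rewrite (len_cat x ayb') {3}yE len_recr// len_id add0r -yE.
  have : len x a y.-1 <= L.
    apply: HL; rewrite ?leqnn//; [idx|idx|].
    rewrite leNgt; apply/negP => h.
    have := ymin y.-1; rewrite h; idx.
  have : d y.-1 y <= D by apply: HD; idx.
  by move: lz; lra.
Qed.

End OneSequence.
End FiniteSelfContracted.

(** * Heavy intervals: the greedy cutting and the extraction step *)

Section Heavy.
Context {R : realType} {X : metricType R} {x : nat -> X} (xP : sc_seq x).
Local Notation d i j := (mdist (x i) (x j)).

(* [b] is the first cut point after [a]; the bound telescopes over two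
   consecutive cut points because a drop of [g] is only known over two pieces. *)
Lemma len_chain (M : R) (g : nat -> R) (s t : nat) : 1 <= M ->
  (forall i j : nat, (s <= i <= j)%N -> (j <= t)%N -> g j <= g i) ->
  (forall a b c : nat, (s <= a <= b)%N -> (b <= c <= t)%N ->
     (M - 1) / 2 * d a b < len x a b -> d a b / 2 <= d b c ->
     d b c <= g a - g c) ->
  forall a : nat, (s <= a < t)%N -> exists2 b : nat, (a < b <= t)%N &
    len x a t <= M * (2 * d a b + 2 * (g a + g b - 2 * g t)).
Proof.
move=> M1 gP HM a; have [n] := ubnP (t - a)%N.
elim: n a => // n IH a ltn sat.
pose Q b := (a < b <= t)%N && (len x a b <= M * d a b).
have Qa1 : Q a.+1.
  have := mdist_ge0 (x a) (x a.+1).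
  rewrite /Q len_recr// len_id add0r => h; apply/andP; split; first idx.
  by rewrite ler_peMl.
have Qt b : Q b -> (b <= t)%N by case/andP => /andP[].
have exQ : exists b, Q b by exists a.+1.
case: (ex_maxnP exQ Qt) => b /andP[abt lab] bmax.
exists b => //.
have gbt : g t <= g b by apply: gP; idx.
have gab : g b <= g a by apply: gP; idx.
have dab : 0 <= d a b := mdist_ge0 _ _.
have [bt|bt] := eqVneq b t.
  rewrite -bt; apply: (le_trans lab); apply: ler_wpM2l; first lra.
  by rewrite bt in gab dab *; lra.
(* By maximality of [b], [b.+1] violates the bound; the last jump is at most [d a b.+1], and [d a b]
   is at most twice [d a b.+1]. *)
have hab : (M - 1) / 2 * d a b < len x a b.
  have abb : (a <= b <= b.+1)%N by idx.
  have := sc_mdist_prefix xP abb.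
  have := xP abb.
  have := bmax b.+1; rewrite /Q ltnn.
  have -> : (a < b.+1 <= t)%N by idx.
  rewrite andTb.
  case: (lerP (len x a b.+1)) => [_ /(_ isT)//|+ _]; rewrite len_recr; last idx.
  move=> h1 h2 h3.
  have : (M - 1) / 2 * d a b <= (M - 1) / 2 * (2 * d a b.+1).
    by apply: ler_wpM2l => //; lra.
  have -> : (M - 1) / 2 * (2 * d a b.+1) = M * d a b.+1 - d a b.+1 by lra.
  lra.
have [||c bct lbt] := IH b; [idx|idx|].
have abt' : (a <= b <= t)%N by idx.
rewrite (len_cat x abt').
have gct : g t <= g c by apply: gP; idx.
have gbc : g c <= g b by apply: gP; idx.
apply: (le_trans (lerD lab lbt)); rewrite -mulrDr; apply: ler_wpM2l; first lra.
(* If the extent halves, the second copy of [d a b] absorbs [2 * d b c]; otherwise the drop of [g]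
   pays for it. *)
have [dbc|dbc] := lerP (d a b / 2) (d b c); last lra.
have : d b c <= g a - g c by apply: HM => //; idx.
lra.
Qed.

Lemma len_chain_le (M : R) (g : nat -> R) (s t : nat) : 1 <= M -> (s <= t)%N ->
  (forall i j : nat, (s <= i <= j)%N -> (j <= t)%N -> g j <= g i) ->
  (forall a b c : nat, (s <= a <= b)%N -> (b <= c <= t)%N ->
     (M - 1) / 2 * d a b < len x a b -> d a b / 2 <= d b c ->
     d b c <= g a - g c) ->
  len x s t <= M * (4 * d s t + 4 * (g s - g t)).
Proof.
move=> M1 st gP HM; have [->|neq_st] := eqVneq s t.
  by rewrite len_id mdistxx subrr !mulr0 addr0 mulr0.
have st' : (s <= s < t)%N by idx.
have [b sbt lst] := len_chain M1 gP HM st'.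
apply: (le_trans lst); apply: ler_wpM2l; first lra.
have sbt' : (s <= b <= t)%N by idx.
have := sc_mdist_prefix xP sbt'.
have : g b <= g s by apply: gP; idx.
lra.
Qed.

Lemma heavy_step (al K : R) (N : nat) (P : seq nat) (s t : nat) :
  0 < al -> 0 <= K -> (s <= t)%N -> (forall p, p \in P -> (t <= p)%N) ->
  (forall (r : R) (z : seq nat), 0 < r -> all (fun i => s <= i <= t)%N z ->
     pairwise (fun i j => (i <= j)%N && (r <= d i j <= 16 * r)) z ->
     (size z <= N)%N) ->
  (1 + 2 * N%:R * (K / 4 + 2)) * (4 + 4 * (al^-1 * (size P)%:R)) * d s t
     < len x s t ->
  exists u v j : nat, [/\ (s <= u <= v)%N, (v <= j <= t)%N,
    K * d u v < len x u v, 2 * d u v <= d v j &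
    forall p, p \in P -> d u p - d j p <= al * d v j].
Proof.
set M := 1 + _ => al0 K0 st HP HN; apply: contraPP => noheavy; apply/negP.
rewrite -leNgt.
(* The factor [al^-1] turns a drop of [al * d b c] in the sum into the drop of [d b c] required by
   [len_chain_le]. *)
pose g i := al^-1 * \sum_(p <- P) d i p.
have gap i j p : p \in P -> (i <= j <= t)%N -> d j p <= d i p.
  by move=> pP ijt; apply: xP; have := HP p pP; idx.
have gmono i j : (s <= i <= j)%N -> (j <= t)%N -> g j <= g i.
  move=> sij jt; apply: ler_wpM2l; first by rewrite invr_ge0 ltW.
  rewrite !big_seq; apply: ler_sum => p pP; apply: gap => //; idx.
have M1 : 1 <= M.
  by rewrite lerDl; apply: mulr_ge0; [apply: mulr_ge0 => //|lra].
have gst : g s - g t <= al^-1 * ((size P)%:R * d s t).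
  rewrite /g -mulrBr -sumrB; apply: ler_wpM2l; first by rewrite invr_ge0 ltW.
  rewrite mulr_natl -iter_addr_0 -count_predT -big_const_seq.
  apply: ler_sum => p _; rewrite lerBlDr; exact: metric_triangle.
apply: (@le_trans _ _ (M * (4 * d s t + 4 * (g s - g t)))); last first.
  have <- : M * (4 * d s t + 4 * (al^-1 * ((size P)%:R * d s t))) =
      M * (4 + 4 * (al^-1 * (size P)%:R)) * d s t by ring.
  by apply: ler_wpM2l; lra.
apply: len_chain_le => // a b c sab bct lab dbc.
pose D := d a b.
have D0 : 0 < D.
  apply: (len_gt0_mdist_gt0 xP); first idx.
  by apply: le_lt_trans lab; apply: mulr_ge0; [lra|exact: mdist_ge0].
(* Otherwise [len_subdivision] at scale [D / 4], with jumps at most [2 * D], contradicts [lab]; [M]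
   is chosen to match its bound. *)
have [u [v [auv vb duv luv]]] : exists u v : nat, [/\ (a <= u <= v)%N, (v <= b)%N,
    d u v <= D / 4 & K * (D / 4) < len x u v].
  apply: contrapT => nouv.
  have : len x a b <= N%:R * (K * (D / 4) + 2 * D).
    apply: (len_subdivision xP (r := D / 4)) => //; try lra; try idx.
    - by apply: mulr_ge0 => //; lra.
    - move=> u v auv vb duv; rewrite leNgt; apply/negP => h.
      by apply: nouv; exists u, v.
    - by move=> u v auv vb; apply: sc_mdist_sub.
    (* Cut points are between [D / 8] and [2 * D] apart, whence the factor 16. *)
    - move=> z zab zr; apply: (HN (D / 8)); first lra.
        apply/allP => i /(allP zab); idx.
      apply: sub_in_pairwise zab zr => i j; rewrite !unfold_in => iab jab /andP[ij dij].
      rewrite ij /=; apply/andP; split; first lra.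
      have : d i j <= 2 * d a b by apply: sc_mdist_sub => //; idx.
      by rewrite -/D; lra.
  have -> : N%:R * (K * (D / 4) + 2 * D) = (M - 1) / 2 * D by rewrite /M; lra.
  by rewrite leNgt lab.
(* If [g] dropped less, [u, v, c] would be the excluded triple: one bad [p] alone makes the sum drop
   by more than [al * d b c]. *)
apply: contrapT => /negP; rewrite -ltNge => gac.
apply: noheavy; exists u, v, c; split => //; try idx.
- by apply: le_lt_trans luv; apply: ler_wpM2l.
- have : d b c <= d v c by apply: xP; idx.
  by move: duv dbc; rewrite -/D; lra.
move=> p pP; rewrite leNgt; apply/negP => bad; move: gac.
rewrite ltNge => /negP; apply.
rewrite /g -mulrBr ler_pdivlMl// -sumrB (big_rem p)//=.
have : 0 <= \sum_(q <- rem p P) (d a q - d c q).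
  rewrite big_seq; apply: sumr_ge0 => q /mem_rem qP.
  by rewrite subr_ge0; apply: gap => //; idx.
have : al * d b c <= al * d v c by rewrite ler_pM2l//; apply: xP; idx.
have : d u p <= d a p by apply: gap => //; idx.
lra.
Qed.

End Heavy.

(** * Ramsey's theorem for coloured pairs *)

Section Ramsey.

Local Open Scope nat_scope.

Lemma size_sum_count (T : Type) (f : T -> nat) (c : nat) (s : seq T) :
  all (fun a => f a < c) s ->
  size s = \sum_(i < c) count (fun a => f a == i) s.
Proof.
elim: s => [|a s IH] /=; first by rewrite big1.
case/andP => fa /IH ->; rewrite big_split /= -add1n; congr addn.
rewrite (bigD1 (Ordinal fa)) //= eqxx big1 // => i /negP neq.
by apply/eqP; rewrite eqb0; apply/negP => /eqP ai; apply: neq; apply/eqP/val_inj.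
Qed.

Lemma pigeonhole_count (T : Type) (f : T -> nat) (c m : nat) (s : seq T) :
  0 < c -> all (fun a => f a < c) s -> c * m <= size s ->
  exists i, m <= count (fun a => f a == i) s.
Proof.
move=> c0 fc; rewrite (size_sum_count fc) => cm; apply: contrapT => small.
have {}small i : count (fun a => f a == i) s < m.
  by rewrite ltnNge; apply/negP => h; apply: small; exists i.
have : \sum_(i < c) count (fun a => f a == i) s <= \sum_(i < c) m.-1.
  by apply: leq_sum => i _; have := small i; lia.
rewrite sum_nat_const card_ord; have := small 0.
by move: cm; nia.
Qed.

(* Each element of [w] carries the colour of all its pairs with later elements. *)
Lemma prehomogeneous (T : eqType) (col : T -> T -> nat) (c n : nat) (s : seq T) :
  0 < c -> pairwise (fun a b => col a b < c) s -> c.+1 ^ n <= size s ->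
  exists w : seq (T * nat), [/\ size w = n, subseq (map fst w) s,
    all (fun a => a.2 < c) w & pairwise (fun a b => col a.1 b.1 == a.2) w].
Proof.
move=> c0; elim: n s => [|n IH] s cols sn; first by exists [::]; rewrite sub0seq.
case: s cols sn => [|a s]; first by rewrite leqn0 expn_eq0.
rewrite pairwise_cons => /andP[cola cols] sn.
have [|i ci] := @pigeonhole_count _ (col a) c (c.+1 ^ n) s c0 cola.
  by move: sn; rewrite /= expnS mulSn; have := expn_gt0 c.+1 n; lia.
have [||w [wn wQ wc wcol]] := IH [seq b <- s | col a b == i].
- exact: subseq_pairwise (filter_subseq _ _) cols.
- by rewrite size_filter.
have wi : all (fun b => col a b.1 == i) w.
  apply/allP => b bw; have : b.1 \in [seq b <- s | col a b == i].
    by apply: (mem_subseq wQ); apply: map_f.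
  by rewrite mem_filter => /andP[].
(* The bound [i < c] is read off an element of [w]; the last element has no later one and gets
   colour 0. *)
exists ((a, if nilp w then 0 else i) :: w); split => /=.
- by rewrite wn.
- by rewrite eqxx; apply: subseq_trans wQ (filter_subseq _ _).
- rewrite wc andbT; case: (w) wQ => [//|b w'] /= wQ.
  have : b.1 \in [seq b <- s | col a b == i].
    by apply: (mem_subseq wQ); rewrite inE eqxx.
  by rewrite mem_filter => /andP[/eqP <-] /(allP cola).
- by rewrite wcol andbT; case: (w) wi.
Qed.

(** Pigeonhole on the colours carried by a prehomogeneous sequence of length [c * k]. *)
Lemma Ramsey_ordered_pairs (c k : nat) : 0 < c ->
  exists N, forall (T : eqType) (col : T -> T -> nat) (s : seq T),
  pairwise (fun a b => col a b < c) s -> N <= size s ->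
  exists i w, [/\ size w = k, subseq w s & pairwise (fun a b => col a b == i) w].
Proof.
move=> c0; exists (c.+1 ^ (c * k)) => T col s cols sN.
have [w [wn ws wc wcol]] := prehomogeneous c0 cols sN.
have [|i ki] := @pigeonhole_count _ snd c k w c0 wc; first by rewrite wn.
pose v := [seq a <- w | a.2 == i].
exists i, (take k (map fst v)); split.
- by rewrite size_takel// size_map size_filter.
- apply: (subseq_trans (take_subseq _ _)); apply: subseq_trans ws.
  exact: map_subseq (filter_subseq _ _).
apply: (subseq_pairwise (take_subseq _ _)); rewrite pairwise_map.
have : all (fun a => a.2 == i) v by exact: filter_all.
have : pairwise (fun a b => col a.1 b.1 == a.2) v.
  exact: subseq_pairwise (filter_subseq _ _) wcol.
elim: v => //= a v IH /andP[av pv] /andP[/eqP ai vi]; rewrite IH// andbT.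
by apply: sub_all av => b /=; rewrite ai.
Qed.

End Ramsey.

Lemma pairwise_in2 (T : eqType) (r : rel T) (s : seq T) : symmetric r ->
  pairwise r s -> {in s &, forall a b, a != b -> r a b}.
Proof.
move=> rC; elim: s => //= a s IH /andP[ra /IH rs] b c.
rewrite !inE => /orP[/eqP ->|bs] /orP[/eqP ->|cs]; last exact: rs.
- by rewrite eqxx.
- by move=> _; exact: (allP ra).
- by move=> _; rewrite rC; exact: (allP ra).
Qed.

(** * Packing bound in sets free of k-point SRA subspaces *)

Section Packing.
Context {R : realType} {X : metricType R}.

Definition SRA_triple (al : R) (x y z : X) :=
  mdist x y <= Num.max (mdist x z + al * mdist z y) (al * mdist x z + mdist z y).

Lemma free_of_SRA_seq (al : R) (k : nat) (S : set X) (w : seq X) :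
  free_of_SRA k al S -> size w = k -> uniq w -> (forall y, y \in w -> S y) ->
  (forall a b c, a \in w -> b \in w -> c \in w -> SRA_triple al a b c) -> False.
Proof.
move=> fS wk uw wS wT.
apply: (fS [set` w]) => [y /= /wS //| |a b c /= aw bw cw]; last exact: wT.
case: w wk uw {wS wT} => [<- _|y0 w wk uw].
  suff -> : [set` [::]] = (set0 : set X) by rewrite II0 card_eq00.
  by apply/seteqP; split.
have -> : [set` y0 :: w] = nth y0 (y0 :: w) @` `I_k.
  apply/seteqP; split => [y /= yw|_ /= [i ik <-]]; last by apply: mem_nth; rewrite wk.
  by exists (index y (y0 :: w)); rewrite ?nth_index// -wk index_mem.
apply: inj_card_eq => i j; rewrite !inE /= => ik jk /eqP.
by rewrite nth_uniq ?wk// => /eqP.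
Qed.

Lemma SRA_triple_degenerate (al : R) (a b c : X) : 0 < al ->
  [|| a == b, a == c | b == c] -> SRA_triple al a b c.
Proof.
have d0 := @mdist_ge0 R X.
rewrite /SRA_triple => al0 /or3P[] /eqP ->; rewrite ?mdistxx ?mulr0 le_max;
  rewrite ?add0r ?addr0 ?lexx ?orbT //.
by apply/orP; left; apply: addr_ge0 => //; apply: mulr_ge0 => //; exact: ltW.
Qed.

Lemma SRA_triple_near_equilateral (al rho : R) (a b c : X) : 0 < al ->
  mdist a b <= (1 + al) * rho -> rho <= mdist a c -> rho <= mdist c b ->
  SRA_triple al a b c.
Proof.
move=> al0 ab ac cb; rewrite /SRA_triple le_max; apply/orP; left.
have : al * rho <= al * mdist c b by rewrite ler_pM2l.
by lra.
Qed.

Lemma geometric_ge (al B : R) : 0 < al -> exists2 c : nat, (0 < c)%N & B <= (1 + al) ^+ c.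
Proof.
move=> al0; have bern n : 1 + n%:R * al <= (1 + al) ^+ n.
  elim: n => [|n IH]; first by rewrite mul0r addr0 expr0.
  rewrite exprS -natr1; have : 0 <= n%:R * al * al.
    by rewrite !mulr_ge0 // ltW.
  have : (1 + al) * (1 + n%:R * al) <= (1 + al) * (1 + al) ^+ n.
    by apply: ler_wpM2l; lra.
  by lra.
have B0 : 0 <= `|B| / al by rewrite divr_ge0// ltW.
exists (Num.bound (`|B| / al)).+1 => //; apply: le_trans (bern _).
have := archi_boundP B0; rewrite ltr_pdivrMr// -natr1.
by have := ler_norm B; lra.
Qed.

(** Colour a pair by the band of ratio [1 + al] containing its distance; [c] bands cover the range
    from [r] to [16 * r]. By Ramsey, too many points contain [k] with all distances in one band, and
    these are SRA by [SRA_triple_near_equilateral]. *)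
Lemma free_of_SRA_packing (al : R) (k : nat) : 0 < al ->
  exists N, forall S : set X, free_of_SRA k al S -> forall (r : R) (z : seq X),
    0 < r -> (forall y, y \in z -> S y) ->
    pairwise (fun a b => r <= mdist a b <= 16 * r) z -> (size z <= N)%N.
Proof.
move=> al0; have [c c0 c16] := geometric_ge 16 al0.
have [N HN] := Ramsey_ordered_pairs k c0.
exists N => S fS r z r0 zS zr; rewrite leqNgt; apply/negP => Nz.
pose below (a b : X) n := mdist a b <= r * (1 + al) ^+ n.+1.
pose col a b := find (below a b) (iota 0 c).
have belowC a b : below a b = below b a by apply/funext => n; rewrite /below metric_sym.
have dcol a b : r <= mdist a b <= 16 * r -> (col a b < c)%N.
  move=> /andP[_ ab]; rewrite /col -[X in (_ < X)%N](size_iota 0 c) -has_find.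
  apply/hasP; exists c.-1; first by rewrite mem_iota; lia.
  rewrite /below prednK//; apply: (le_trans ab).
  by rewrite mulrC ler_pM2l.
have [||i [w [wk wz wcol]]] := HN X col z.
- by apply: sub_pairwise zr => a b /dcol.
- exact: ltnW.
pose rr : rel X := fun a b => (r <= mdist a b <= 16 * r) && (col a b == i).
have rrC : symmetric rr by move=> a b; rewrite /rr /col belowC metric_sym.
have wr : pairwise rr w.
  by rewrite pairwise_relI wcol (subseq_pairwise wz zr).
have bnd a b : rr a b -> r * (1 + al) ^+ i <= mdist a b <= (1 + al) * (r * (1 + al) ^+ i).
  case/andP=> rab /eqP abi; have := dcol _ _ rab; rewrite abi => ic.
  have hb : has (below a b) (iota 0 c) by rewrite has_find size_iota -/(col a b) abi.
  have := nth_find 0 hb; rewrite -/(col a b) abi nth_iota// add0n /below => up.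
  apply/andP; split; last by rewrite mulrCA -exprS.
  (* The lower end of band 0 is the separation [r]; that of a later band comes from the minimality
     in [find]. *)
  case: i abi {ic up wcol rr rrC wr} => [_|i abi]; first by rewrite expr0 mulr1; case/andP: rab.
  have : (i < find (below a b) (iota 0 c))%N by rewrite -/(col a b) abi.
  move=> /(before_find 0); rewrite nth_iota; last first.
    by rewrite -ltnS -abi; exact: leqW (dcol _ _ rab).
  by rewrite add0n /below => /negbT; rewrite -ltNge => /ltW.
have win := pairwise_in2 rrC wr.
apply: (free_of_SRA_seq fS wk) => [|y yw|a b e aw bw ew].
- apply: (pairwise_uniq (r := rr)) => // a; rewrite /rr mdistxx.
  by rewrite leNgt r0.
- by apply: zS; exact: (mem_subseq wz).
have [ab|ab] := eqVneq a b; first by apply: SRA_triple_degenerate; rewrite ?ab ?eqxx.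
have [ae|ae] := eqVneq a e.
  by apply: SRA_triple_degenerate; rewrite ?ae ?eqxx ?orbT.
have [be|be] := eqVneq b e.
  by apply: SRA_triple_degenerate; rewrite ?be ?eqxx ?orbT.
have /bnd/andP[_ ab2] := win _ _ aw bw ab.
have /bnd/andP[ae1 _] := win _ _ aw ew ae.
have /bnd/andP[be1 _] := win _ _ bw ew be.
by apply: (SRA_triple_near_equilateral al0 ab2 ae1); rewrite metric_sym.
Qed.

End Packing.

(** * The nested construction and the length estimate *)

(** Each induction step takes [j] from [heavy_step] and recurses into [[u,v]] with [j] added to [P].
    As [K] depends on the size [m] of [P], [m] is generalized. The inequality against [P] yields the
    triples through [j] one level up. *)
Lemma nested_SRA {R : realType} {X : metricType R} (al : R) (N n m : nat) :
  0 < al -> exists2 K : R, 0 <= K &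
  forall (x : nat -> X) (s t : nat) (P : seq nat),
  sc_seq x -> (s <= t)%N -> size P = m -> (forall p, p \in P -> (t <= p)%N) ->
  (forall (r : R) (z : seq nat), 0 < r -> all (fun i => s <= i <= t)%N z ->
     pairwise (fun i j => (i <= j)%N && (r <= mdist (x i) (x j) <= 16 * r)) z ->
     (size z <= N)%N) ->
  K * mdist (x s) (x t) < len x s t ->
  exists q : seq nat, [/\ size q = n, forall i, i \in q -> (s <= i <= t)%N,
    uniq (map x q),
    forall p i j, p \in P -> i \in q -> j \in q ->
      mdist (x i) (x p) - mdist (x j) (x p) <= al * mdist (x i) (x j) &
    forall i j l, i \in q -> j \in q -> l \in q -> SRA_triple al (x i) (x j) (x l)].
Proof.
move=> al0; elim: n m => [|n IH] m.
  by exists 0 => // x s t P _ _ _ _ _ _; exists [::].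
have [K K0 HK] := IH m.+1.
have alV : 0 <= al^-1 by rewrite invr_ge0 ltW.
exists ((1 + 2 * N%:R * (K / 4 + 2)) * (4 + 4 * (al^-1 * m%:R))).
  apply: mulr_ge0.
    by apply: addr_ge0 => //; apply: mulr_ge0; [exact: mulr_ge0|lra].
  by apply: addr_ge0 => //; apply: mulr_ge0 => //; exact: mulr_ge0.
move=> x s t P xP st Pm HP HN; rewrite -{1}Pm => /(heavy_step xP al0 K0 st HP HN).
case=> u [v [j [suv vjt luv duv goodj]]].
have d0 (a b : nat) : 0 <= mdist (x a) (x b) := mdist_ge0 _ _.
have duv0 : 0 < mdist (x u) (x v).
  apply: (len_gt0_mdist_gt0 xP); first idx.
  by apply: le_lt_trans luv; exact: mulr_ge0.
have [|||||q [qn quv qu qP qT]] := HK x u v (j :: P) xP.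
- idx.
- by rewrite /= Pm.
- move=> p; rewrite inE => /orP[/eqP ->|/HP]; idx.
- move=> r z r0 zuv; apply: HN => //.
  by apply: sub_all zuv => i; idx.
- by [].
have far i : i \in q -> mdist (x v) (x j) <= mdist (x i) (x j).
  by move=> /quv iuv; apply: xP; idx.
have close a b : a \in q -> b \in q -> mdist (x a) (x b) <= mdist (x v) (x j).
  move=> /quv auv /quv buv; apply: le_trans duv.
  have [ab|/ltnW ba] := leqP a b; first by apply: (sc_mdist_sub xP); idx.
  by rewrite metric_sym; apply: (sc_mdist_sub xP); idx.
exists (j :: q); split.
- by rewrite /= qn.
- by move=> i; rewrite inE => /orP[/eqP ->|/quv]; idx.
- rewrite /= qu andbT; apply/mapP => -[i iq xji].
  by have := far i iq; rewrite -xji mdistxx; lra.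
- move=> p a b pP; rewrite !inE => /orP[/eqP ->|aq] /orP[/eqP ->|bq].
  + by rewrite subrr mdistxx mulr0.
  + have : mdist (x j) (x p) <= mdist (x b) (x p).
      by apply: xP; have := HP p pP; have := quv b bq; idx.
    by move=> h; apply: (@le_trans _ _ 0); [lra|rewrite mulr_ge0// ltW].
  + have := goodj p pP; have : mdist (x a) (x p) <= mdist (x u) (x p).
      by apply: xP; have := HP p pP; have := quv a aq; idx.
    have : al * mdist (x v) (x j) <= al * mdist (x a) (x j).
      by rewrite ler_pM2l// far.
    by lra.
  + by apply: qP; rewrite // inE pP orbT.
have qj a b : a \in q -> b \in q ->
    mdist (x a) (x j) <= mdist (x b) (x j) + al * mdist (x a) (x b).
  by move=> aq bq; rewrite -lerBlDl; apply: qP => //; rewrite inE eqxx.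
have ald (a b : nat) : 0 <= al * mdist (x a) (x b) by rewrite mulr_ge0// ltW.
move=> a b e; rewrite !inE.
have deg a' b' e' := @SRA_triple_degenerate R X al a' b' e' al0.
(* If [j] is one of the first two points, [qj] applies; if it is the third, the other two are no
   farther from each other than [v] from [j], hence than either from [j]. *)
case/orP=> [/eqP ->|aq] /orP[/eqP ->|bq] /orP[/eqP ->|eq];
  try by apply: deg; rewrite eqxx ?orbT.
- have := qj b e bq eq; rewrite /SRA_triple le_max => h; apply/orP; left.
  by move: h; rewrite ![mdist _ (x j)]metric_sym [mdist (x b) (x e)]metric_sym.
- have := qj a e aq eq; rewrite /SRA_triple le_max => h; apply/orP; right; lra.
- have := close a b aq bq; have := far a aq; have := ald j b.
  by rewrite /SRA_triple le_max => *; apply/orP; left; lra.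
- exact: qT.
Qed.

Lemma free_of_SRA_len {R : realType} {X : metricType R} (al : R) (k : nat) :
  0 < al -> exists2 K : R, 0 <= K &
  forall S : set X, free_of_SRA k al S ->
  forall (x : nat -> X) (s t : nat), sc_seq x -> (s <= t)%N ->
  (forall i : nat, (s <= i <= t)%N -> S (x i)) ->
  len x s t <= K * mdist (x s) (x t).
Proof.
move=> al0; have [N HN] := @free_of_SRA_packing R X al k al0.
have [K K0 HK] := @nested_SRA R X al N k 0 al0.
exists K => // S fS x s t xP st xS; rewrite leNgt; apply/negP => heavy.
have [||q [qk qst qu _ qT]] := HK x s t [::] xP st erefl _ _ heavy.
- by [].
- move=> r z r0 zst zr; rewrite -(size_map x); apply: (HN S fS r) => //.
    by move=> y /mapP[i /(allP zst) ist ->]; exact: xS.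
  by rewrite pairwise_map; apply: sub_pairwise zr => i j /andP[].
apply: (free_of_SRA_seq fS (w := map x q)) => //.
- by rewrite size_map.
- by move=> y /mapP[i /qst ist ->]; exact: xS.
by move=> _ _ _ /mapP[i iq ->] /mapP[j jq ->] /mapP[l lq ->]; exact: qT.
Qed.

(** * Uniform bounds on compact sets *)

Section CompactSets.
Context {R : realType} {X : metricType R}.

Lemma free_of_SRA_mono (al : R) (k n : nat) (S T : set X) : (k <= n)%N ->
  T `<=` S -> free_of_SRA k al S -> free_of_SRA n al T.
Proof.
move=> kn TS fS Y YT Yn YSRA.
have finY : finite_set Y by exists n.
have mY y : y \in take k (finmap.enum_fset (fset_set Y)) -> Y y.
  by move/mem_take; rewrite in_fset_set// inE.
apply: (free_of_SRA_seq fS (w := take k (finmap.enum_fset (fset_set Y)))).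
- by rewrite size_takel// (card_fset_set Yn).
- by rewrite take_uniq// finmap.fset_uniq.
- by move=> y /mY /YT /TS.
- by move=> a b c /mY Ya /mY Yb /mY Yc; exact: YSRA.
Qed.

(** A single [n] gives both the number of points and the radius, so that the filter [\oo] expresses
    the uniform choice; [free_of_SRA_mono] lets [n] grow. *)
Lemma compact_locally_SRA_free (al : R) (C : set X) : compact C ->
  locally_SRA_free X al ->
  exists n : nat, forall y, C y -> free_of_SRA n al (ball y (n.+1%:R^-1)).
Proof.
move=> /compact_near_coveringP cC loc.
have [|N _ HN] := cC nat \oo
    (fun n y => free_of_SRA n al (ball y (n.+1%:R^-1))) _; last first.
  by exists N => y Cy; apply: HN => //=.
move=> x _; have [r r0 [k fk]] := loc x.
have r20 : 0 < r / 2 by lra.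
exists (ball x (r / 2), [set n : nat | (maxn k (Num.bound (r / 2)^-1) <= n)%N]) => /=.
  split; first exact: nbhsx_ballx.
  by exists (maxn k (Num.bound (r / 2)^-1)).
move=> [y n] /= [xy]; rewrite geq_max => /andP[kn rn].
apply: (free_of_SRA_mono kn _ fk) => w yw.
have nr : n.+1%:R^-1 <= r / 2.
  rewrite -[leRHS]invrK lef_pV2 ?posrE ?invr_gt0//.
  apply: ltW; apply: (lt_le_trans (archi_boundP _)); first by rewrite invr_ge0 ltW.
  by rewrite ler_nat; apply: leqW.
by rewrite (splitr r); apply: ball_triangle xy _; exact: (le_ball nr).
Qed.

(** Near-covering compactness for the filter of lists ordered by inclusion. *)
Lemma compact_net (C : set X) (e : R) : compact C -> 0 < e ->
  exists c : seq X, forall y, C y -> has (fun a => mdist a y < e) c.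
Proof.
move=> /compact_near_coveringP cC e0.
pose F := filter_from [set: seq X] (fun c0 => [set c : seq X | {subset c0 <= c}]).
have FF : Filter F.
  apply: filter_from_filter; first by exists [::].
  move=> c1 c2 _ _; exists (c1 ++ c2) => // c /= sub.
  by split=> a ac; apply: sub; rewrite mem_cat ac ?orbT.
have [|c0 _ Hc0] := cC _ F (fun c y => has (fun a => mdist a y < e) c) FF; last first.
  by exists c0 => y Cy; apply: (Hc0 c0) => //=.
move=> x _; exists (ball x e, [set c : seq X | {subset [:: x] <= c}]) => /=.
  by split; [exact: nbhsx_ballx|exists [:: x]].
move=> [y c] /= [xy xc]; apply/hasP; exists x; first by apply: xc; rewrite inE eqxx.
by move: xy; rewrite ballEmdist.
Qed.

Lemma net_packing (c z : seq X) (e : R) :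
  (forall y, y \in z -> has (fun a => mdist a y < e) c) ->
  pairwise (fun a b => 2 * e <= mdist a b) z -> (size z <= size c)%N.
Proof.
move=> zc zr; pose f y := find (fun a => mdist a y < e) c.
have fz y : y \in z -> (f y < size c)%N by move=> /zc; rewrite has_find.
rewrite -(size_map f) -(size_iota 0 (size c)); apply: uniq_leq_size; last first.
  by move=> _ /mapP[y /fz yc ->]; rewrite mem_iota.
rewrite uniq_pairwise pairwise_map.
apply: (sub_in_pairwise (P := mem z)) zr; last by apply/allP.
move=> y w yz wz /=; apply: contraTneq => fyw.
have /zc cy := yz; have /zc cw := wz.
move: (nth_find y cy) (nth_find y cw); rewrite -/(f y) -/(f w) -fyw => h1 h2.
rewrite -ltNge; have := metric_triangle y (nth y c (f y)) w.
by rewrite (metric_sym y (nth _ _ _)); lra.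
Qed.

Lemma compact_len_bounded (al M : R) (C : set X) : 0 < al -> compact C ->
  locally_SRA_free X al -> 0 <= M -> (forall a b, C a -> C b -> mdist a b <= M) ->
  exists2 B : R, 0 <= B &
  forall (x : nat -> X) (t : nat), sc_seq x -> (forall i, C (x i)) -> len x 0 t <= B.
Proof.
move=> al0 cC loc M0 CM; have [n fn] := compact_locally_SRA_free cC loc.
pose rho : R := n.+1%:R^-1.
have rho0 : 0 < rho by rewrite invr_gt0.
have [K K0 HK] := @free_of_SRA_len R X al n al0.
(* A piece of extent [rho / 3] lies in the [rho]-ball about its first point, as distances at most
   double; cut points are [rho / 6] apart, twice the mesh of the net. *)
have [c Hc] := @compact_net C (rho / 12) cC ltac:(lra).
have KM0 : 0 <= K * (rho / 3) by apply: mulr_ge0; lra.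
exists ((size c)%:R * (K * (rho / 3) + M)); first by apply: mulr_ge0 => //; lra.
move=> x t xP xC; apply: (len_subdivision xP (r := rho / 3)) => //; first lra.
- move=> u v /andP[_ uv] vt duv; apply: (@le_trans _ _ (K * mdist (x u) (x v))).
    apply: (HK _ (fn _ (xC u))) => // i uiv; rewrite ballEmdist /= -/rho.
    by have := sc_mdist_prefix xP uiv; lra.
  by apply: ler_wpM2l.
- by move=> u v _ _; apply: CM.
move=> z _ zr; rewrite -(size_map x); apply: (@net_packing _ _ (rho / 12)).
  by move=> _ /mapP[i _ ->]; apply: Hc.
by rewrite pairwise_map; apply: sub_pairwise zr => i j /andP[_] /=; lra.
Qed.

End CompactSets.

(** * From curves to finite sequences *)

Lemma polygonal_length_sc_seq {R : realType} {X : metricType R} (I : set R)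
    (gamma : R -> X) (s : seq R) :
  self_contracted I gamma -> sorted <%R s -> (forall t, t \in s -> I t) ->
  s != [::] ->
  exists2 x : nat -> X, sc_seq x &
    (forall i, (gamma @` I) (x i)) /\
    polygonal_length gamma s = len x 0 (size s).-1.
Proof.
move=> sc s_lt sI s0; have ss : (0 < size s)%N by case: (s) s0.
(* Repeating the last point forever keeps the sequence self-contracted and inside the curve. *)
pose cap i := minn i (size s).-1.
have capP i : (cap i < size s)%N by rewrite /cap; lia.
have inI i : I s`_(cap i) by apply/sI/mem_nth.
have mono i j : (i <= j)%N -> s`_(cap i) <= s`_(cap j).
  move=> ij; apply: (sorted_leq_nth le_trans (@lexx _ _)); rewrite ?inE//.
    by apply: sub_sorted s_lt => a b; exact: ltW.
  by rewrite /cap; lia.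
exists (fun i => gamma s`_(cap i)); last split.
- by move=> i j k /andP[ij jk]; apply: sc => //; exact: mono.
- by move=> i; exists s`_(cap i).
rewrite /polygonal_length /len big_mkord; apply: eq_bigr => -[i /= ilt] _.
by congr (mdist (gamma s`_ _) (gamma s`_ _)); rewrite /cap; lia.
Qed.

Unset Implicit Arguments.

Theorem theorem1 (R : realType) (X : metricType R) (alpha : R)
    (alpha_gt : 2^-1 < alpha) (alpha_lt1 : alpha < 1)
    (HX : SRA_free alpha [set: X] \/
          (proper_metric X /\ locally_SRA_free X alpha))
    (I : set R) (Iitv : is_interval I) (gamma : R -> X)
    (gamma_bounded : metric_bounded (gamma @` I))
    (gamma_sc : self_contracted I gamma) :
  rectifiable I gamma.
Proof.
have alpha0 : 0 < alpha by lra.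
suff [B B0 HB] : exists2 B : R, 0 <= B & forall (x : nat -> X) (t : nat),
    sc_seq x -> (forall i, (gamma @` I) (x i)) -> len x 0 t <= B.
  apply: (@le_lt_trans _ _ B%:E); last exact: ltry.
  apply: ge_ereal_sup => _ [s [s_lt sI] <-]; rewrite lee_fin.
  have [->|s0] := eqVneq s [::]; first by rewrite /polygonal_length big_ord0.
  have [x xP [xI ->]] := polygonal_length_sc_seq gamma_sc s_lt sI s0.
  exact: HB.
have [M HM] := gamma_bounded.
have [HX1|[prop loc]] := HX.
  have [k fk] := HX1; have [K K0 HK] := @free_of_SRA_len R X alpha k alpha0.
  exists (K * `|M|); first exact: mulr_ge0.
  move=> x t xP xI; apply: (@le_trans _ _ (K * mdist (x 0%N) (x t))).
    exact: (HK _ fk).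
  by apply: ler_wpM2l => //; apply: le_trans (ler_norm M); exact: HM.
(* A point of the curve is needed as centre of the compact closed ball of radius |M| that contains
   the image. *)
have [[t0 It0]|I0] := pselect (exists t, I t); last first.
  by exists 0 => // x t _ /(_ 0%N) [t0 It0]; case: I0; exists t0.
have [||B B0 HB] := compact_len_bounded (M := 2 * `|M|) alpha0 (prop (gamma t0) `|M|) loc.
- exact: mulr_ge0.
- move=> a b /= ta tb; have := metric_triangle a (gamma t0) b.
  by rewrite (metric_sym a (gamma t0)); lra.
exists B => // x t xP xI; apply: HB => // i /=.
by apply: le_trans (ler_norm M); apply: HM => //; exists t0.
Qed.
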